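(* The functions $T_n$, $n\ge 0$, are rational functions of $x$ (i.e. $x=\cos t\mapsto T_n(\cos t)$ is the restriction to $[-1,1]$ of a rational function), and for every $n\ge 1$ they satisfy the three-term recurrence relation $$\frac{x-a_{n+1}}{\sqrt{a_{n+1}^2-1}}\,T_{n+1}(x)+\left[\left(\frac{a_n}{\sqrt{a_n^2-1}}+\frac{a_{n+1}}{\sqrt{a_{n+1}^2-1}}\right)x-\frac{1}{\sqrt{a_n^2-1}}-\frac{1}{\sqrt{a_{n+1}^2-1}}\right]T_n(x)+\frac{x-a_{n}}{\sqrt{a_{n}^2-1}}\,T_{n-1}(x)=0.$$
   Context: Let $\{a_k\}_{k=1}^\infty$ be a sequence of distinct real numbers with $a_k\notin[-1,1]$. The symbol $\sqrt{x^2-1}$ denotes the branch analytic on $\mathbb{C}\setminus[-1,1]$ with $\sqrt{x^2-1}\sim x$ as $x\to\infty$ (so it is negative for real $x<-1$). Put $c_k=a_k-\sqrt{a_k^2-1}$; then $c_k$ is real, $0<|c_k|<1$ and $a_k=\frac12(c_k+c_k^{-1})$. Define $f_0(z)\equiv 1$ and $f_n(z)=\prod_{k=1}^n\frac{z-c_k}{1-c_kz}$. The Chebyshev rational functions of the first kind $T_n$ are defined on $[-1,1]$ by $T_n(\cos t)=\operatorname{Re} f_n(e^{it})$, $t\in[0,\pi]$ (so $T_0=1$). *)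

(* Defs.v *)
From HB Require Import structures.
From mathcomp Require Import all_boot all_order all_algebra.
From mathcomp Require Import all_classical all_reals all_analysis.
From mathcomp Require Import complex.
From mathcomp Require Import ring lra.

Set Implicit Arguments.
Unset Strict Implicit.
Unset Printing Implicit Defensive.

Import Order.TTheory GRing.Theory Num.Theory numFieldNormedType.Exports.

Local Open Scope classical_set_scope.
Local Open Scope ring_scope.
Local Open Scope complex_scope.

(* The complex numbers over R are R[i]; the alias R[i]^o carries their
   structure of a normed space over themselves, so that derivability in
   direction 1 at a point of R[i]^o is complex differentiability there. *)

Definition on_cut (R : realType) (z : R[i]) : Prop :=
  exists2 x : R, -1 <= x <= 1 & z = x%:C.

(* w is the branch of sqrt (z ^ 2 - 1) that is analytic off [-1, 1] and
   equivalent to z at infinity; its values on the cut are irrelevant. *)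
Record is_sqrt_branch (R : realType) (w : R[i] -> R[i]) : Prop := {
  sqrt_branch_analytic : forall z : R[i], ~ on_cut z ->
    derivable (w : R[i]^o -> R[i]^o) z 1;
  sqrt_branch_sqr : forall z : R[i], ~ on_cut z -> w z ^+ 2 = z ^+ 2 - 1;
  sqrt_branch_infty : forall e : R, 0 < e -> exists M : R,
    forall z : R[i], M%:C < `|z| -> `|w z / z - 1| < e%:C }.

Section Chebyshev.
Variables (R : realType) (w : R[i] -> R[i]) (a : nat -> R).

(* a and c are indexed from 1; the value at 0 is never used. *)
Definition cheb_c (k : nat) : R[i] := (a k)%:C - w (a k)%:C.

Definition cheb_f (n : nat) (z : R[i]) : R[i] :=
  \prod_(1 <= k < n.+1) ((z - cheb_c k) / (1 - cheb_c k * z)).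

Definition expi (t : R) : R[i] := cos t +i* sin t.

Definition cheb_T (n : nat) (x : R) : R :=
  complex.Re (cheb_f n (expi (acos x))).

Lemma cheb_T_cos n t : 0 <= t <= pi ->
  cheb_T n (cos t) = complex.Re (cheb_f n (expi t)).
Proof. by move=> tpi; rewrite /cheb_T cosK // in_itv. Qed.

End Chebyshev.

Definition rational_on_cut (R : realType) (f : R -> R) : Prop :=
  exists p q : {poly R}, forall x : R, -1 <= x <= 1 ->
    q.[x] != 0 /\ f x = p.[x] / q.[x].

(* The branch exists, so quantifying over the functions w satisfying
   is_sqrt_branch is not vacuous. *)
Section Existence.
Variable R : realType.
Implicit Types u v z : R[i].

Let ps (u : R[i]) : R[i] := sqrtc u.
Let w0 (z : R[i]) : R[i] := z * ps (1 - z^-1 ^+ 2).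

Let Re_ps_ge0 u : 0 <= complex.Re (ps u).
Proof. by case: u => x y; rewrite /ps /= sqrtr_ge0. Qed.

Let ps_dist u v :
  (complex.Re (ps v))%:C * `|ps v - ps u| <= `|v - u|.
Proof.
rewrite -[in leRHS](sqr_sqrtc v) -[in leRHS](sqr_sqrtc u) subr_sqr normrM.
rewrite mulrC ler_wpM2l //; apply: le_trans (normc_ge_Re _).
rewrite lecR; apply: le_trans (ler_norm _).
by rewrite raddfD /= lerDl Re_ps_ge0.
Qed.

Let Re_ps_gt0 z : z != 0 -> ~ on_cut z ->
  0 < complex.Re (ps (1 - z^-1 ^+ 2)).
Proof.
move=> z0 zcut; rewrite lt_neqAle Re_ps_ge0 andbT; apply/eqP => s0.
apply: zcut; have /= := sqr_sqrtc (1 - z^-1 ^+ 2).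
rewrite -/(ps _); case: (ps _) s0 => x y /= <-.
have -> : (0 +i* y) ^+ 2 = - (y ^+ 2)%:C :> R[i].
  by rewrite expr2; simpc; rewrite -expr2.
move=> /eqP; rewrite eq_sym subr_eq addrC -subr_eq => /eqP h.
pose r := Num.sqrt (1 + y ^+ 2).
have r1 : 1 <= r by rewrite -sqrtr1 ler_sqrt ?lerDl ?sqr_ge0 ?addr_ge0 ?sqr_ge0.
have r0 : 0 < r by apply: lt_le_trans r1.
have rV : 0 <= r^-1 <= 1 by rewrite invr_ge0 ltW //= invf_le1.
have /eqP : (z^-1) ^+ 2 = r%:C ^+ 2.
  rewrite -rmorphXn /= sqr_sqrtr ?addr_ge0 ?sqr_ge0 // rmorphD /= -h.
  by rewrite opprK rmorph1; ring.
rewrite eqf_sqr => /orP[]/eqP zr.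
  exists r^-1; last by rewrite fmorphV /= -zr invrK.
  by case/andP: rV => *; apply/andP; split=> //; lra.
exists (- r^-1); last by rewrite rmorphN fmorphV /= -[r%:C]opprK -zr invrN opprK invrK.
by case/andP: rV => *; apply/andP; split; lra.
Qed.

Let not_cut_neq0 z : ~ on_cut z -> z != 0.
Proof.
move=> zcut; apply/eqP => z0; apply: zcut; exists 0; last by rewrite z0.
by rewrite lerN10 ler01.
Qed.

Let w0_sqr z : z != 0 -> w0 z ^+ 2 = z ^+ 2 - 1.
Proof.
by move=> z0; rewrite /w0 exprMn sqr_sqrtc; field.
Qed.

Let ps_cvg (v : R[i]^o) : 0 < complex.Re (ps v) ->
  ((ps u : R[i]^o) @[u --> v] --> (ps v : R[i]^o)).
Proof.
move=> v0; have c0 : 0 < (complex.Re (ps v))%:C by rewrite ltcR.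
apply/(@cvgrPdist_lt _ R[i]^o _ _ (nbhs_filter v)) => e e0.
have h : \forall u \near v, `|v - u| < (complex.Re (ps v))%:C * e.
  have /(@cvgrPdist_lt _ R[i]^o _ _ (nbhs_filter v)) := @cvg_id _ (nbhs v).
  by apply; exact: mulr_gt0.
apply: (@filterS _ (nbhs v) (nbhs_filter v) _ _ _ h) => u hu.
by rewrite -(ltr_pM2l c0); apply: le_lt_trans (ps_dist _ _) hu.
Qed.

Let w0_cvg (z : R[i]^o) : ~ on_cut z ->
  ((w0 u : R[i]^o) @[u --> z] --> (w0 z : R[i]^o)).
Proof.
move=> zcut; have z0 := not_cut_neq0 zcut.
have FF : Filter (nbhs z) := nbhs_filter z.
have idz : (u : R[i]^o) @[u --> z] --> z by exact: cvg_id.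
have Vz : (u^-1 : R[i]^o) @[u --> z] --> (z^-1 : R[i]^o).
  by apply: (@cvgV R[i]^o _ (nbhs z) FF id z z0 idz).
have VVz := @cvgM R[i]^o _ _ FF _ _ _ _ Vz Vz.
have Bz := @cvgB R[i] R[i]^o _ _ FF _ _ _ _ (cvg_cst (1 : R[i]^o)) VVz.
have sz := ps_cvg (Re_ps_gt0 z0 zcut).
have Cz : (ps (1 - u^-1 ^+ 2) : R[i]^o) @[u --> z] -->
    (ps (1 - z^-1 ^+ 2) : R[i]^o).
  by apply: (cvg_comp _ _ (Bz FF) sz).
exact: (@cvgM R[i]^o _ _ FF _ _ _ _ idz Cz).
Qed.

Lemma sqrt_branch_exists : exists w : R[i] -> R[i], is_sqrt_branch w.
Proof.
exists w0; split.
- move=> z zcut; have z0 := not_cut_neq0 zcut.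
  have wz0 : w0 z != 0.
    rewrite mulf_neq0 //; apply/eqP => s0.
    by have := Re_ps_gt0 z0 zcut; rewrite s0 ltxx.
  have FF : Filter (0 : R[i]^o)^' := dnbhs_filter (0 : R[i]^o).
  have id0 : (h : R[i]^o) @[h --> (0 : R[i]^o)^'] --> (0 : R[i]^o).
    exact: nbhs_dnbhs.
  have cst0 (c : R[i]^o) : (c : R[i]^o) @[h --> (0 : R[i]^o)^'] --> c.
    by exact: (@cvg_cst _ c _ _ FF).
  have addz (c : R[i]^o) :
      (h + c : R[i]^o) @[h --> (0 : R[i]^o)^'] --> (c : R[i]^o).
    rewrite -[X in _ --> X](add0r c).
    exact: (@cvgD R[i] R[i]^o _ _ FF _ _ _ _ id0 (cst0 c)).
  have ws : (w0 (h + z) : R[i]^o) @[h --> (0 : R[i]^o)^'] --> (w0 z : R[i]^o).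
    by apply: (cvg_comp _ _ (addz z) (w0_cvg zcut)).
  have ww : (w0 (h + z) + w0 z : R[i]^o) @[h --> (0 : R[i]^o)^'] -->
      (w0 z + w0 z : R[i]^o).
    exact: (@cvgD R[i] R[i]^o _ _ FF _ _ _ _ ws (cst0 (w0 z))).
  have ww0 : w0 z + w0 z != 0 by rewrite -mulr2n mulrn_eq0 negb_or /=.
  have quo : ((h + (z + z)) / (w0 (h + z) + w0 z) : R[i]^o)
      @[h --> (0 : R[i]^o)^'] --> ((z + z) / (w0 z + w0 z) : R[i]^o).
    apply: (@cvgM R[i]^o _ _ FF _ _ _ _ (addz (z + z))).
    exact: (@cvgV R[i]^o _ _ FF _ _ ww0 ww).
  have nz (f : R[i] -> R[i]) (l : R[i]^o) : l != 0 ->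
      (f h : R[i]^o) @[h --> (0 : R[i]^o)^'] --> l ->
      \forall h \near (0 : R[i]^o)^', f h != 0.
    move=> l0 fl; have l1 : 0 < `|l| by rewrite normr_gt0.
    have := (iffLR (@cvgrPdist_lt _ R[i]^o _ _ FF _ _)) fl _ l1.
    apply: (@filterS _ _ FF) => h; apply: contraTneq => ->.
    by rewrite subr0 ltxx.
  apply/cvg_ex; exists ((z + z) / (w0 z + w0 z)).
  apply: cvg_trans quo; apply: near_eq_cvg.
  have h1 := nz _ _ z0 (addz z).
  have h2 := nz _ _ ww0 ww.
  have h3 := @nbhs_dnbhs_neq R[i]^o 0.
  have h12 := @filterI _ _ FF _ _ h1 h2.
  apply: (@filterS2 _ _ FF _ _ _ _ h12 h3) => h /= [hz hw] h0.
  rewrite [h *: 1]mulr1 /GRing.scale /=.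
  apply: (mulfI h0); rewrite mulVKf //; apply: (mulIf hw).
  by rewrite -mulrA divfK // -subr_sqr !w0_sqr //; ring.
- by move=> z /not_cut_neq0; exact: w0_sqr.
- move=> e e0; exists (1 + e^-1) => z zM.
  have M1 : 1 < 1 + e^-1 by rewrite ltrDl invr_gt0.
  have nz1 : 1 < `|z| by apply: lt_trans zM; rewrite -[1]/(1%:C) ltcR.
  have nz0 : 0 < `|z| by apply: lt_trans nz1.
  have z0 : z != 0 by rewrite -normr_gt0.
  rewrite /w0 mulrAC mulfV // mul1r.
  have := ps_dist (1 - z^-1 ^+ 2) 1.
  rewrite /ps sqrtc1 /= mul1r subKr distrC => /le_lt_trans; apply.
  rewrite normrX normfV.
  apply: (@lt_trans _ _ `|z|^-1).
    by rewrite expr2 gtr_pMl ?invr_gt0 // invf_lt1.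
  have eC : 0 < e%:C by rewrite ltcR.
  have eM : (e%:C)^-1 < `|z|.
    by apply: le_lt_trans zM; rewrite -fmorphV /= lecR lerDr.
  by rewrite -[ltRHS]invrK ltf_pV2 // posrE invr_gt0.
Qed.
End Existence.

(* Main.v *)
Require Import Defs.
From mathcomp Require Import all_boot all_order all_algebra.
From mathcomp Require Import all_classical all_reals all_analysis.
From mathcomp Require Import complex.
From mathcomp Require Import ring lra.

Import Order.TTheory GRing.Theory Num.Theory.

Local Open Scope ring_scope.
Local Open Scope complex_scope.

(** Write z = x + iy for a point of the unit circle, s_k for the value of the
branch at a_k, and b_k = (z - c_k) / (1 - c_k z), so that f_n = b_1 ... b_n.
Since s_k^2 = a_k^2 - 1 > 0, the number s_k is real, and c_k = a_k - s_k
satisfies c_k (a_k + s_k) = 1.  Everything rests on the identity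
[blaschke_factorE]

  (x - a_k) b_k = (1 - a_k x) - i s_k y,

whose right-hand side is affine in x and y.

Rationality: multiplying these identities gives
D f_n = P(x) + i y Q(x) for polynomials P, Q and D = prod_k (x - a_k), because
y^2 = 1 - x^2 is a polynomial in x; taking real parts, T_n = P / D, and D has
no zero on [-1, 1] ([cheb_f_rational]).

Recurrence: put G = f_n.  Dividing the identity for b_{n+1} by s_{n+1} and
taking the real part of its product with G,

  (x - a_{n+1}) / s_{n+1} T_{n+1} = (1 - a_{n+1} x) / s_{n+1} T_n + y Im G.

As |b_n| = 1, f_{n-1} = G conj(b_n), and the conjugate identity gives

  (x - a_n) / s_n T_{n-1} = (1 - a_n x) / s_n T_n - y Im G.

The terms in Im G, which do not depend on the poles, cancel in the sum; what
remains is the recurrence. *)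

Section UnitCircle.
Context {R : realType}.
Implicit Types a s x y : R.

Lemma sqrt_branch_real (w : R[i] -> R[i]) a : is_sqrt_branch w ->
    ~~ (-1 <= a <= 1) ->
  exists s, [/\ w a%:C = s%:C, s ^+ 2 = a ^+ 2 - 1 & s != 0].
Proof.
move=> w_branch a_out; have a2_gt1 : 0 < a ^+ 2 - 1.
  by move: a_out; rewrite negb_and -!ltNge => /orP[] ?; nra.
have a_cut : ~ on_cut a%:C.
  by case=> x xI [ax]; move: a_out; rewrite ax xI.
pose r := Num.sqrt (a ^+ 2 - 1).
have r2 : r ^+ 2 = a ^+ 2 - 1 by rewrite sqr_sqrtr // ltW.
have r0 : r != 0 by rewrite gt_eqF // sqrtr_gt0.
have /eqP : w a%:C ^+ 2 = r%:C ^+ 2.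
  by rewrite (sqrt_branch_sqr w_branch a_cut) -!rmorphXn /= r2 rmorphB.
rewrite eqf_sqr => /orP[]/eqP ->; first by exists r.
by exists (- r); rewrite rmorphN sqrrN oppr_eq0.
Qed.

Lemma sub_pole_neq0 a x : ~~ (-1 <= a <= 1) -> -1 <= x <= 1 -> x - a != 0.
Proof. by move=> a_out xI; rewrite subr_eq0; apply: contraNneq a_out => <-. Qed.

(** With z = x + iy and c = a - s, one has 1 + c^2 = 2ac, hence
x - a = - (1 - cz)(1 - c/z) / (2c). So multiplying the left-hand side by x - a
cancels the denominator and leaves - (z - c)(1 - c/z) / (2c), which is affine
in z and 1/z = x - iy. *)
Lemma blaschke_factorE a s x y :
    s ^+ 2 = a ^+ 2 - 1 -> x ^+ 2 + y ^+ 2 = 1 -> x - a != 0 ->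
  ((x +i* y) - (a%:C - s%:C)) / (1 - (a%:C - s%:C) * (x +i* y)) =
  ((1 - a * x) -i* (s * y)) / (x - a)%:C.
Proof.
move=> s2 xy1 xa0; have y2 : y ^+ 2 = 1 - x ^+ 2 by rewrite -xy1; ring.
have xaC0 : (x - a)%:C != 0 by rewrite fmorph_eq0.
have c0 : a - s != 0.
  apply/eqP => c0; have : (a - s) * (a + s) = 1 by ring: s2.
  by move/eqP; rewrite c0 mul0r eq_sym oner_eq0.
have den0 : 1 - (a%:C - s%:C) * (x +i* y) != 0.
  (* the squared modulus of 1 - cz is 2c(a - x) *)
  apply/eqP; simpc => -[Re0 Im0].
  have : (1 - (a - s) * x) ^+ 2 + ((a - s) * y) ^+ 2 = 2 * (a - s) * (a - x).
    by ring: s2 y2.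
  have -> : (a - s) * y = 0 by lra.
  have -> : 1 - (a - s) * x = 0 by lra.
  move/eqP; rewrite expr0n addr0 eq_sym !mulf_eq0 pnatr_eq0 (negPf c0) /=.
  by rewrite -oppr_eq0 opprB (negPf xa0).
apply/eqP; rewrite eqr_div //; apply/eqP; simpc.
by congr (_ +i* _); ring: s2 y2.
Qed.

Lemma expi_acos x : -1 <= x <= 1 ->
  expi (acos x) = x +i* Num.sqrt (1 - x ^+ 2).
Proof. by move=> xI; rewrite /expi acosK ?sin_acos ?in_itv. Qed.

Lemma upper_circle x : -1 <= x <= 1 ->
  x ^+ 2 + Num.sqrt (1 - x ^+ 2) ^+ 2 = 1.
Proof.
by move=> /andP[x1 x2]; rewrite sqr_sqrtr; [ring | nra].
Qed.

End UnitCircle.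

Section Recurrence.
Context {R : realType} {w : R[i] -> R[i]} {a : nat -> R}.
Hypothesis w_branch : is_sqrt_branch w.
Hypothesis a_out : forall k : nat, (0 < k)%N -> ~~ (-1 <= a k <= 1).

Lemma cheb_fS n s x y : w (a n.+1)%:C = s%:C -> s ^+ 2 = a n.+1 ^+ 2 - 1 ->
    x ^+ 2 + y ^+ 2 = 1 -> x - a n.+1 != 0 ->
  cheb_f w a n.+1 (x +i* y) =
  cheb_f w a n (x +i* y) * (((1 - a n.+1 * x) -i* (s * y)) / (x - a n.+1)%:C).
Proof.
move=> ws s2 xy1 xa0; rewrite /cheb_f big_nat_recr //= /cheb_c ws.
by rewrite blaschke_factorE.
Qed.

(** The form (P + i y Q) / D is preserved by multiplication by a further
factor, because y^2 is a polynomial in x; this makes the induction go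
through, which the statement about the real part alone would not. *)
Lemma cheb_f_rational n : exists p q d : {poly R}, forall x, -1 <= x <= 1 ->
  d.[x] != 0 /\
  cheb_f w a n (expi (acos x)) =
    (p.[x] +i* (Num.sqrt (1 - x ^+ 2) * q.[x])) / d.[x]%:C.
Proof.
elim: n => [|n [p [q [d IH]]]].
  exists 1, 0, 1 => x _; rewrite !hornerE oner_neq0; split=> //.
  by rewrite /cheb_f big_geq // rmorph1 invr1.
have [s [ws s2 _]] := sqrt_branch_real _ _ w_branch (a_out _ (ltn0Sn n)).
pose A : {poly R} := 1 - a n.+1 *: 'X.
exists (p * A + s *: (q * (1 - 'X ^+ 2))), (q * A - s *: p).
exists (d * ('X - (a n.+1)%:P)) => x xI.
have [d0 fE] := IH x xI.
have xa0 := sub_pole_neq0 _ _ (a_out _ (ltn0Sn n)) xI.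
split; first by rewrite hornerM hornerXsubC mulf_neq0.
move: fE; rewrite expi_acos // => fE.
rewrite (cheb_fS _ _ _ _ ws s2 (upper_circle _ xI) xa0) fE mulf_div.
rewrite hornerM hornerXsubC rmorphM /=; congr (_ / _).
have y2 : Num.sqrt (1 - x ^+ 2) ^+ 2 = 1 - x ^+ 2.
  by rewrite -[in RHS](upper_circle _ xI); ring.
move: y2; move: (Num.sqrt _) => y y2; rewrite /A -polyC1.
rewrite !(hornerD, hornerN, hornerM, hornerZ, hornerXn, hornerX, hornerC).
by simpc; congr (_ +i* _); ring: y2.
Qed.

(** Multiplying f_n by the next factor mixes its real and imaginary parts; once
both sides are divided by s, the coefficient y of the imaginary part is the
same for every pole. *)
Lemma cheb_T_next n s x : w (a n.+1)%:C = s%:C ->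
    s ^+ 2 = a n.+1 ^+ 2 - 1 -> s != 0 -> -1 <= x <= 1 ->
  (x - a n.+1) / s * cheb_T w a n.+1 x =
  (1 - a n.+1 * x) / s * cheb_T w a n x
  + Num.sqrt (1 - x ^+ 2) * complex.Im (cheb_f w a n (expi (acos x))).
Proof.
move=> ws s2 s0 xI; have xa0 := sub_pole_neq0 _ _ (a_out _ (ltn0Sn n)) xI.
rewrite /cheb_T expi_acos // (cheb_fS _ _ _ _ ws s2 (upper_circle _ xI) xa0).
case: (cheb_f w a n _) => u v; rewrite -fmorphV; simpc => /=.
by field; rewrite s0 xa0.
Qed.

(** The factor has modulus 1, so the previous product is recovered from the
current one by multiplying by the conjugate factor; hence the sign of the
last term is opposite to that in [cheb_T_next]. *)
Lemma cheb_T_prev n s x : w (a n.+1)%:C = s%:C ->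
    s ^+ 2 = a n.+1 ^+ 2 - 1 -> s != 0 -> -1 <= x <= 1 ->
  (x - a n.+1) / s * cheb_T w a n x =
  (1 - a n.+1 * x) / s * cheb_T w a n.+1 x
  - Num.sqrt (1 - x ^+ 2) * complex.Im (cheb_f w a n.+1 (expi (acos x))).
Proof.
move=> ws s2 s0 xI; have xa0 := sub_pole_neq0 _ _ (a_out _ (ltn0Sn n)) xI.
have xy1 := upper_circle _ xI.
rewrite /cheb_T expi_acos // (cheb_fS _ _ _ _ ws s2 xy1 xa0).
have y2 : Num.sqrt (1 - x ^+ 2) ^+ 2 = 1 - x ^+ 2 by rewrite -[in RHS]xy1; ring.
move: y2; move: (Num.sqrt _) => y y2.
case: (cheb_f w a n _) => u v; rewrite -fmorphV; simpc => /=.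
apply: (mulIf s0); apply: (mulIf xa0).
(* |1 - a x - i s y|^2 = (x - a)^2 *)
have unimod : (1 - a n.+1 * x) ^+ 2 + s ^+ 2 * y ^+ 2 = (x - a n.+1) ^+ 2.
  by ring: s2 y2.
transitivity ((x - a n.+1) ^+ 2 * u); first by field.
by rewrite -unimod; field; rewrite s0 xa0.
Qed.

End Recurrence.

Theorem theorem3p1 (R : realType) (w : R[i] -> R[i]) (a : nat -> R)
    (w_branch : is_sqrt_branch w)
    (a_out : forall k : nat, (0 < k)%N -> ~~ (-1 <= a k <= 1))
    (a_distinct : forall j k : nat, (0 < j)%N -> (0 < k)%N ->
       a j = a k -> j = k) :
  (forall n : nat, rational_on_cut (cheb_T w a n)) /\
  (forall (n : nat) (x : R), (0 < n)%N -> -1 <= x <= 1 ->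
     let s (k : nat) : R[i] := w (a k)%:C in
     (x%:C - (a n.+1)%:C) / s n.+1 * (cheb_T w a n.+1 x)%:C
     + (((a n)%:C / s n + (a n.+1)%:C / s n.+1) * x%:C
        - (s n)^-1 - (s n.+1)^-1) * (cheb_T w a n x)%:C
     + (x%:C - (a n)%:C) / s n * (cheb_T w a n.-1 x)%:C = 0).
Proof.
split=> [n | [//|n] x _ xI /=].
  have [p [q [d fE]]] := cheb_f_rational w_branch a_out n.
  exists p, d => x xI; have [d0 fx] := fE x xI; split=> //.
  by rewrite /cheb_T fx -fmorphV; simpc.
have [s [ws s2 s0]] := sqrt_branch_real _ _ w_branch (a_out _ (ltn0Sn n)).
have [t [wt t2 t0]] := sqrt_branch_real _ _ w_branch (a_out _ (ltn0Sn n.+1)).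
rewrite ws wt -!fmorphV -!(rmorphB, rmorphM, rmorphD) /=.
rewrite (cheb_T_next a_out _ _ _ wt t2 t0 xI).
rewrite (cheb_T_prev a_out _ _ _ ws s2 s0 xI).
rewrite [X in X%:C](_ : _ = 0) //.
by ring.
Qed.
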